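(* Let $B$ be a basis, $E_B=A_B^{-1}D_B$, and let $E_B=QUQ^H$ be its Schur decomposition ($Q$ unitary, $U$ upper triangular). After a preprocessing that does not depend on $\lambda$, for any given $\lambda$ such that $I+\lambda E_B$ is invertible, $x_B(\lambda)$ can be computed in $\mathcal{O}(m^2)$ and $o_B(\lambda)$ can be computed in $\mathcal{O}(m^2)$.
   Context: Let $A, D \in \mathbb{R}^{m\times n}$, $b\in\mathbb{R}^m$, $c\in\mathbb{R}^n$, and for $\lambda\in\mathbb{R}$ let $\mathcal{P}(\lambda)$ be the linear program $\min\{c^T x : Ax+\lambda Dx=b,\ x\ge 0\}$. A basis $B$ is a choice of $m$ column indices such that $A_B$ is invertible; $M_B$ denotes the submatrix of a matrix $M$ (or subvector of a vector) formed by the columns (entries) indexed by $B$. Whenever $A_B+\lambda D_B$ is invertible (equivalently $I+\lambda E_B$ is invertible), $x_B(\lambda) = (A_B+\lambda D_B)^{-1}b$ and $o_B(\lambda) = c_B^T x_B(\lambda)$. Complexity is the number of arithmetic operations over $\mathbb{C}$ (unit cost). The matrices $Q,U,Q^H$, the vector $x_B(0)=A_B^{-1}b$, and any other quantity not depending on $\lambda$ may be computed once in the preprocessing, whose cost is not counted in the per-$\lambda$ cost. *)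

(* Defs.v *)
From mathcomp Require Import all_boot all_order all_algebra.
From mathcomp Require Import complex reals.

Set Implicit Arguments.
Unset Strict Implicit.
Unset Printing Implicit Defensive.

Import Order.TTheory GRing.Theory Num.Theory.

Local Open Scope ring_scope.
Local Open Scope complex_scope.
Local Open Scope sesquilinear_scope.

(* A basis lists m column indices, in some order. Invertibility of A_B forces
   these indices to be pairwise distinct. *)
Definition is_basis (R : realType) (m n : nat) (A : 'M[R]_(m, n))
  (B : 'I_m -> 'I_n) : bool := colsub B A \in unitmx.

Definition E_B (R : realType) (m n : nat) (A D : 'M[R]_(m, n))
  (B : 'I_m -> 'I_n) : 'M[R]_m := invmx (colsub B A) *m colsub B D.

Definition x_B (R : realType) (m n : nat) (A D : 'M[R]_(m, n)) (b : 'cV[R]_m)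
  (B : 'I_m -> 'I_n) (lambda : R) : 'cV[R]_m :=
  invmx (colsub B A + lambda *: colsub B D) *m b.

Definition o_B (R : realType) (m n : nat) (A D : 'M[R]_(m, n)) (b : 'cV[R]_m)
  (c : 'cV[R]_n) (B : 'I_m -> 'I_n) (lambda : R) : R :=
  ((rowsub B c)^T *m x_B A D b B lambda) 0 0.

Definition to_complex (R : realType) (m n : nat) (M : 'M[R]_(m, n)) :
  'M[R[i]]_(m, n) := map_mx (real_complex R) M.

(* is_trig_mx means lower triangular, hence the transpose. *)
Definition schur_decomposition (R : realType) (m : nat) (E : 'M[R]_m)
  (Q U : 'M[R[i]]_m) : Prop :=
  [/\ Q \is unitarymx, is_trig_mx U^T & to_complex E = Q *m U *m Q^t*].

(* Straight-line programs over a field. An operand is the parameter, a cell of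
   the table of precomputed values, or the result of an earlier instruction
   (numbered from 0). A program contains no scalar, so it cannot depend on the
   data other than through the table and the parameter. *)
Variant operand := Param | Table of nat | Result of nat.

Variant arith_op := Add | Sub | Mul | Div.

Record instruction :=
  Instruction { op : arith_op; arg1 : operand; arg2 : operand }.

Record program := Program { code : seq instruction; outputs : seq operand }.

(* Each instruction is one arithmetic operation. *)
Definition cost (p : program) : nat := size (code p).

Definition fetch (F : Type) (tab : seq F) (t : F) (res : seq F) (a : operand) :
  option F :=
  match a with
  | Param => Some t
  | Table k => onth tab k
  | Result k => onth res k
  end.

Definition apply_op (F : fieldType) (o : arith_op) (x y : F) : option F :=
  match o with
  | Add => Some (x + y)
  | Sub => Some (x - y)
  | Mul => Some (x * y)
  | Div => if y == 0 then None else Some (x / y)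
  end.

Definition exec (F : fieldType) (tab : seq F) (t : F) (res : seq F)
  (i : instruction) : option F :=
  if fetch tab t res (arg1 i) is Some x then
    if fetch tab t res (arg2 i) is Some y then apply_op (op i) x y else None
  else None.

Fixpoint exec_code (F : fieldType) (tab : seq F) (t : F) (res : seq F)
  (s : seq instruction) : option (seq F) :=
  if s is i :: s' then
    if exec tab t res i is Some z then exec_code tab t (rcons res z) s'
    else None
  else Some res.

(* None when the run divides by zero or an instruction reads an undefined
   operand; an output that cannot be read shows up as a None entry. *)
Definition run (F : fieldType) (p : program) (tab : seq F) (t : F) :
  option (seq (option F)) :=
  if exec_code tab t [::] (code p) is Some res then
    Some [seq fetch tab t res a | a <- outputs p]
  else None.

Definition computes (F : fieldType) (p : program) (tab : seq F) (t : F)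
  (v : seq F) : Prop := run p tab t = Some [seq Some y | y <- v].

Definition entries (T : Type) (m n : nat) (M : 'M[T]_(m, n)) : seq T :=
  [seq M i j | i <- enum 'I_m, j <- enum 'I_n].

(* The precomputed values: Q, U, Q^H, the vector x_B(0), then arbitrary
   further ones. *)
Definition preprocessed (R : realType) (m : nat) (Q U : 'M[R[i]]_m)
  (x0 : 'cV[R]_m) (extra : seq R[i]) : seq R[i] :=
  entries Q ++ entries U ++ entries (Q^t*) ++ entries (to_complex x0) ++ extra.

(* Main.v *)
Require Import Defs.
From mathcomp Require Import all_boot all_order all_algebra.
From mathcomp Require Import complex reals.
From mathcomp Require Import ring.

Set Implicit Arguments.
Unset Strict Implicit.
Unset Printing Implicit Defensive.

Import Order.TTheory GRing.Theory Num.Theory.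

Local Open Scope ring_scope.
Local Open Scope complex_scope.

(** Put y = Q^H x_B(0), w = Q^T c_B and T = I + lambda U. The equation
    (I + lambda E_B) x_B(lambda) = x_B(0), multiplied on the left by Q^H,
    becomes T z = y for z = Q^H x_B(lambda) ([schur_coordinatesP]). The vector y
    does not depend on lambda, and T is upper triangular and invertible, hence
    has a nonzero diagonal ([schur_diag_neq0]). So back substitution finds z in
    O(m^2) operations ([solveP], [size_solve]), whereas elimination on
    A_B + lambda D_B would take O(m^3) for each lambda.
    Then x_B(lambda) = Q z costs one matrix-vector product ([matvecP],
    [size_matvec]), and o_B(lambda) = w^T z one inner product ([dotP],
    [size_dot]), where w is independent of lambda as well.

    The straight-line programs are generated by functions that take the code
    written so far and return a longer code together with the operands that
    hold the new results. They manipulate addresses in the table, never values,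
    so that the resulting programs depend on m alone. *)

(** * Code fragments and the values they compute *)

Section Evaluation.

Variables (F : fieldType) (tab : seq F) (t : F).

Implicit Types (s : seq instruction) (a b : operand) (v x y z : F).

Definition evals s a v : Prop := computes (Program s [:: a]) tab t [:: v].

(** The form in which a code generator promises that earlier results stay
    available. Since [evals s Param t] means that s runs without error,
    [extends s s'] also carries this property over from s to s'. *)
Definition extends s s' : Prop := forall a v, evals s a v -> evals s' a v.

Lemma extends_trans s1 s2 s3 : extends s1 s2 -> extends s2 s3 -> extends s1 s3.
Proof. by move=> h12 h23 a v /h12/h23. Qed.

Lemma evalsP s a v :
  evals s a v <->
  exists2 res, exec_code tab t [::] s = Some res & fetch tab t res a = Some v.
Proof.
rewrite /evals /computes /run /=; case: exec_code => [res|]; last first.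
  by split=> // -[].
by split=> [[eq_v]|[_ [<-] ->]] //; exists res.
Qed.

Lemma computes_nil s : evals s Param t -> computes (Program s [::]) tab t [::].
Proof. by case/evalsP=> res run_s _; rewrite /computes /run /= run_s. Qed.

Lemma computes_cons s a (l : seq operand) v (vs : seq F) :
  evals s a v -> computes (Program s l) tab t vs ->
  computes (Program s (a :: l)) tab t (v :: vs).
Proof.
case/evalsP=> res run_s fetch_a; rewrite /computes /run /= run_s => -[->].
by rewrite fetch_a.
Qed.

Lemma evals_empty : evals [::] Param t.
Proof. by []. Qed.

Lemma evals_Table s k v :
  onth tab k = Some v -> evals s Param t -> evals s (Table k) v.
Proof. by move=> tab_k /evalsP[res run_s _]; apply/evalsP; exists res. Qed.

Lemma exec_code_rcons (res : seq F) s (i : instruction) :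
  exec_code tab t res (rcons s i) =
  obind (fun r => omap (rcons r) (exec tab t r i)) (exec_code tab t res s).
Proof.
elim: s res => [|j s IHs] res /=; first by case: (exec _ _ _ i).
by case: (exec _ _ _ j).
Qed.

Lemma size_exec_code (res r : seq F) s :
  exec_code tab t res s = Some r -> size r = (size res + size s)%N.
Proof.
elim: s res => [|i s IHs] res /=; first by case=> ->; rewrite addn0.
by case: (exec _ _ _ i) => // x /IHs ->; rewrite size_rcons addnS.
Qed.

Lemma emitP s (o : arith_op) a b x y v :
  evals s a x -> evals s b y -> apply_op o x y = Some v ->
  extends s (rcons s (Instruction o a b)) /\
  evals (rcons s (Instruction o a b)) (Result (size s)) v.
Proof.
case/evalsP=> res run_s fa /evalsP[res']; rewrite run_s => -[<-] fb op_v.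
have run_i : exec_code tab t [::] (rcons s (Instruction o a b)) =
    Some (rcons res v).
  by rewrite exec_code_rcons run_s /exec /= fa fb op_v.
have size_s := size_exec_code run_s.
split=> [a' v' /evalsP[res'']|]; last first.
  apply/evalsP; exists (rcons res v) => //=.
  by rewrite -cats1 onth_cat size_s ltnn subnn.
rewrite run_s => -[<-] fa'; apply/evalsP; exists (rcons res v) => //.
case: a' fa' => //= k res_k.
by rewrite -cats1 onth_cat -onthTE res_k.
Qed.

End Evaluation.

(** * Inner products *)

Definition muladd (st : seq instruction * operand) (p : operand * operand) :=
  let: (s, acc) := st in
  let s' := rcons s (Instruction Mul p.1 p.2) in
  (rcons s' (Instruction Add acc (Result (size s))), Result (size s')).

Definition dot (s : seq instruction) (zero : operand)
  (ps : seq (operand * operand)) : seq instruction * operand :=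
  foldl muladd (s, zero) ps.

Lemma size_dot s zero ps : size (dot s zero ps).1 = (size s + 2 * size ps)%N.
Proof.
rewrite /dot; elim: ps s zero => [|p ps IHps] s zero /=; first by rewrite addn0.
by rewrite IHps !size_rcons mulnS !addSn !addnS.
Qed.

Lemma dotP (F : fieldType) (tab : seq F) (t : F) s zero (I : eqType)
    (r : seq I) (f g : I -> operand) (vf vg : I -> F) (v0 : F) :
  evals tab t s zero v0 ->
  {in r, forall i, evals tab t s (f i) (vf i)} ->
  {in r, forall i, evals tab t s (g i) (vg i)} ->
  let: (s', a) := dot s zero [seq (f i, g i) | i <- r] in
  extends tab t s s' /\
  evals tab t s' a (v0 + \sum_(i <- r) vf i * vg i).
Proof.
rewrite /dot; elim: r s zero v0 => [|i r IHr] s zero v0 /= ev0 evf evg.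
  by rewrite big_nil addr0; split.
have [s_s1 ev1] := emitP (o := Mul) (evf i (mem_head _ _)) (evg i (mem_head _ _))
  (erefl _).
have [s1_s2 ev2] := emitP (o := Add) (s_s1 _ _ ev0) ev1 (erefl _).
have s_s2 := extends_trans s_s1 s1_s2.
have := IHr _ _ _ ev2; case: foldl => s3 a.
rewrite big_cons addrA => -[j rj|j rj|s2_s3 ev_a].
- by apply/s_s2/evf; rewrite inE rj orbT.
- by apply/s_s2/evg; rewrite inE rj orbT.
by split=> //; apply: extends_trans s_s2 s2_s3.
Qed.

(** * Back substitution and matrix-vector product *)

(** Solves (I + t U) z = y, for U upper triangular with respect to the order of
    the list: the unknown at the head of the list is found from those after it.
    The addresses of the entries of U and y in the table are given by u and y;
    the function returned maps an index to the operand that holds its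
    unknown, and means nothing outside the list. *)
Fixpoint solve (I : eqType) (zero one : nat) (u : I -> I -> nat) (y : I -> nat)
  (r : seq I) : seq instruction * (I -> operand) :=
  if r is i :: r' then
    let: (s0, z) := solve zero one u y r' in
    let: (s1, acc) := dot s0 (Table zero) [seq (Table (u i j), z j) | j <- r'] in
    let s2 := rcons s1 (Instruction Mul Param acc) in
    let s3 := rcons s2 (Instruction Defs.Sub (Table (y i)) (Result (size s1))) in
    let s4 := rcons s3 (Instruction Mul Param (Table (u i i))) in
    let s5 := rcons s4 (Instruction Add (Table one) (Result (size s3))) in
    let s6 := rcons s5 (Instruction Div (Result (size s2)) (Result (size s4))) in
    (s6, fun j => if j == i then Result (size s5) else z j)
  else ([::], fun=> Param).

(** The unknown followed by k others costs 2k + 5 operations, and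
    k^2 + 4k increases by exactly that amount from k to k + 1. *)
Lemma size_solve (I : eqType) zero one u y (r : seq I) :
  size (solve zero one u y r).1 = (size r ^ 2 + 4 * size r)%N.
Proof.
elim: r => [|i r] //=; case: solve => s0 z /= IHr.
have := size_dot s0 (Table zero) [seq (Table (u i j), z j) | j <- r].
case: dot => s1 acc /=; rewrite !size_rcons size_map IHr => ->.
ring.
Qed.

(** The row equations are required in the form in which back substitution uses
    them, one for each splitting of the list at an index i. *)
Lemma solveP (F : fieldType) (tab : seq F) (t : F) (I : eqType)
    (zero one : nat) (u : I -> I -> nat) (y : I -> nat)
    (vu : I -> I -> F) (vy vz : I -> F) (r : seq I) :
  onth tab zero = Some 0 -> onth tab one = Some 1 ->
  (forall i j, onth tab (u i j) = Some (vu i j)) ->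
  (forall i, onth tab (y i) = Some (vy i)) ->
  (forall p i q, r = p ++ i :: q -> 1 + t * vu i i != 0 /\
     vy i - t * (\sum_(j <- q) vu i j * vz j) = vz i * (1 + t * vu i i)) ->
  let: (s, z) := solve zero one u y r in
  evals tab t s Param t /\ {in r, forall j, evals tab t s (z j) (vz j)}.
Proof.
move=> tab0 tab1 tabu taby; elim: r => [|i r IHr] rows /=.
  by split=> //; apply: evals_empty.
case: solve IHr => s0 z [p j q r_eq|run0 evz].
  by apply: (rows (i :: p)); rewrite r_eq.
have [diag_i row_i] := rows [::] i r (erefl _).
have := dotP (evals_Table tab0 run0)
  (fun j _ => evals_Table (tabu i j) run0) evz.
case: dot => s1 acc [s0_s1]; rewrite add0r => ev1; have run1 := s0_s1 _ _ run0.
have [s1_s2 ev2] := emitP (o := Mul) run1 ev1 (erefl _).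
have run2 := s1_s2 _ _ run1.
have [s2_s3 ev3] := emitP (o := Defs.Sub) (evals_Table (taby i) run2) ev2 (erefl _).
have run3 := s2_s3 _ _ run2.
have [s3_s4 ev4] := emitP (o := Mul) run3 (evals_Table (tabu i i) run3) (erefl _).
have run4 := s3_s4 _ _ run3.
have [s4_s5 ev5] := emitP (o := Add) (evals_Table tab1 run4) ev4 (erefl _).
have ev3' := s4_s5 _ _ (s3_s4 _ _ ev3).
have div_i : apply_op Div (vy i - t * (\sum_(j <- r) vu i j * vz j))
    (1 + t * vu i i) = Some (vz i).
  by rewrite /= (negPf diag_i) row_i mulfK.
have [s5_s6 ev6] := emitP ev3' ev5 div_i.
split=> [|j]; first exact/s5_s6/s4_s5.
rewrite inE; case: eqP => [-> _|_ /= rj]; first exact: ev6.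
exact/s5_s6/s4_s5/s3_s4/s2_s3/s1_s2/s0_s1/evz.
Qed.

Fixpoint matvec (I : Type) (zero : nat) (q : I -> I -> nat) (z : I -> operand)
  (cols : seq I) (s : seq instruction) (rows : seq I) :
  seq instruction * seq operand :=
  if rows is i :: rows' then
    let: (s1, a) := dot s (Table zero) [seq (Table (q i j), z j) | j <- cols] in
    let: (s2, l) := matvec zero q z cols s1 rows' in (s2, a :: l)
  else (s, [::]).

Lemma size_matvec (I : Type) zero q z (cols : seq I) s rows :
  size (matvec zero q z cols s rows).1 =
  (size s + 2 * size rows * size cols)%N.
Proof.
elim: rows s => [|i rows IHr] s /=; first by rewrite addn0.
have := size_dot s (Table zero) [seq (Table (q i j), z j) | j <- cols].
case: dot => s1 a /=; rewrite size_map; have := IHr s1; case: matvec => s2 l /=.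
move=> -> ->; ring.
Qed.

Lemma matvecP (F : fieldType) (tab : seq F) (t : F) (I : eqType) (zero : nat)
    (q : I -> I -> nat) (z : I -> operand) (vq : I -> I -> F) (vz : I -> F)
    (cols : seq I) s rows :
  onth tab zero = Some 0 ->
  (forall i j, onth tab (q i j) = Some (vq i j)) ->
  evals tab t s Param t ->
  {in cols, forall j, evals tab t s (z j) (vz j)} ->
  let: (s', l) := matvec zero q z cols s rows in
  extends tab t s s' /\
  computes (Program s' l) tab t
    [seq \sum_(j <- cols) vq i j * vz j | i <- rows].
Proof.
move=> tab0 tabq; elim: rows s => [|i rows IHr] s run_s evz /=.
  by split=> //; apply: computes_nil.
have := dotP (evals_Table tab0 run_s)
  (fun j _ => evals_Table (tabq i j) run_s) evz.
case: dot => s1 a [s_s1]; rewrite add0r => ev_a.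
have := IHr s1; case: matvec => s2 l [|j j_col|s1_s2 evl].
- exact: s_s1.
- exact/s_s1/evz.
split; first exact: extends_trans s_s1 s1_s2.
by apply: computes_cons evl; apply: s1_s2.
Qed.

(** * Layout of the table *)

Lemma onth_allpairs (S T V : Type) (f : S -> T -> V) (s1 : seq S) (s2 : seq T)
    (i j : nat) x y :
  onth s1 i = Some x -> onth s2 j = Some y ->
  onth [seq f x' y' | x' <- s1, y' <- s2] (i * size s2 + j) = Some (f x y).
Proof.
move=> s1i s2j; have lt_j : (j < size s2)%N by rewrite -onthTE s2j.
elim: s1 i s1i => [|x' s1 IHs1] [|i] //=; rewrite onth_cat size_map.
  by case=> ->; rewrite mul0n lt_j onth_map s2j.
rewrite mulSn -addnA => /IHs1 IHi.
by rewrite ltnNge leq_addr /= addKn.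
Qed.

Lemma onth_enum_ord n (i : 'I_n) : onth (enum 'I_n) i = Some i.
Proof.
by rewrite onthE (nth_map i) ?nth_ord_enum // size_enum_ord.
Qed.

Lemma size_entries (T : Type) m n (M : 'M[T]_(m, n)) :
  size (entries M) = (m * n)%N.
Proof. by rewrite size_allpairs !size_enum_ord. Qed.

Lemma onth_entries (T : Type) m n (M : 'M[T]_(m, n)) (l l' : seq T)
    (i : 'I_m) (j : 'I_n) :
  onth (l ++ entries M ++ l') (size l + (i * n + j)) = Some (M i j).
Proof.
have M_ij : onth (entries M) (i * n + j) = Some (M i j).
  rewrite -[X in (_ * X + _)%N](size_enum_ord n).
  by apply: onth_allpairs; apply: onth_enum_ord.
by rewrite onth_cat ltnNge leq_addr /= addKn onth_cat -onthTE M_ij.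
Qed.

(** * The linear system in Schur coordinates *)

Lemma enum_ord_split n (p q : seq 'I_n) i :
  enum 'I_n = p ++ i :: q ->
  (forall j, j \in p -> (j < i)%N) /\ (forall j, j \in q -> (i < j)%N).
Proof.
move=> enum_eq; have := iota_ltn_sorted 0 n.
rewrite -val_enum_ord enum_eq (sorted_pairwise ltn_trans) map_cat pairwise_cat /=.
case/and3P=> /allrelP lt_p _ /andP[/allP lt_q _]; split=> j j_in.
  by apply: lt_p; [apply: map_f | apply: mem_head].
by apply: lt_q; apply: map_f.
Qed.

(** In row i of the system, the columns listed before i vanish because U is
    upper triangular, and those after it are the ones already solved for. *)
Lemma back_substitution_row (F : fieldType) n (U : 'M[F]_n) (t : F)
    (y z : 'cV[F]_n) (p q : seq 'I_n) i :
  is_trig_mx U^T -> (1%:M + t *: U) *m z = y -> enum 'I_n = p ++ i :: q ->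
  y i 0 - t * (\sum_(j <- q) U i j * z j 0) = z i 0 * (1 + t * U i i).
Proof.
move=> /is_trig_mxP U_trig <- enum_eq.
have [lt_p lt_q] := enum_ord_split enum_eq.
rewrite mxE -big_enum /= enum_eq big_cat big_cons /=.
rewrite big_seq big1 ?add0r => [|j /lt_p lt_ji]; last first.
  have := U_trig _ _ lt_ji; rewrite !mxE => ->.
  by rewrite mulr0 addr0 -val_eqE /= gtn_eqF // mul0r.
rewrite [X in _ + X - _](_ : _ = t * (\sum_(j <- q) U i j * z j 0)).
  by rewrite addrK mulrC !mxE eqxx.
rewrite mulr_sumr big_seq [RHS]big_seq; apply: eq_bigr => j /lt_q lt_ij.
by rewrite !mxE -val_eqE /= ltn_eqF // add0r mulrA.
Qed.

Section Schur.

Local Open Scope sesquilinear_scope.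

Variables (R : realType) (m : nat) (E : 'M[R]_m) (Q U : 'M[R[i]]_m).
Hypothesis schurE : schur_decomposition E Q U.

Lemma to_complex_shift (lambda : R) :
  to_complex (1%:M + lambda *: E) = Q *m (1%:M + lambda%:C *: U) *m Q^t*.
Proof.
have [/unitarymxP QQ _ E_eq] := schurE.
rewrite /to_complex map_mxD map_mx1 map_mxZ -/(to_complex E) E_eq.
by rewrite mulmxDr mulmxDl mulmx1 QQ -scalemxAr -scalemxAl.
Qed.

Lemma schur_adjK : Q^t* *m Q = 1%:M.
Proof. by have [/unitarymxP QQ _ _] := schurE; apply: mulmx1C. Qed.

Lemma schur_coordinatesP (lambda : R) (x x0 : 'cV[R]_m) :
  (1%:M + lambda *: E) *m x = x0 ->
  (1%:M + lambda%:C *: U) *m (Q^t* *m to_complex x) = Q^t* *m to_complex x0.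
Proof.
move=> <-; rewrite [to_complex (_ *m _)]map_mxM -/(to_complex _).
by rewrite -/(to_complex x) to_complex_shift !mulmxA schur_adjK mul1mx.
Qed.

(** I + lambda E is similar to a triangular matrix with diagonal entries
    1 + lambda U_ii, whose product is therefore its determinant. *)
Lemma schur_diag_neq0 (lambda : R) i :
  1%:M + lambda *: E \in unitmx -> 1 + lambda%:C * U i i != 0.
Proof.
have [_ /is_trig_mxP U_trig _] := schurE.
rewrite -(map_unitmx (real_complex R)) -/(to_complex _) to_complex_shift.
rewrite !unitmx_mul => /andP[/andP[_ T_unit] _]; move: T_unit.
rewrite unitmxE -det_tr det_trig ?unitfE; last first.
  apply/is_trig_mxP=> j k lt_jk; have := U_trig _ _ lt_jk.
  by rewrite !mxE => ->; rewrite mulr0 addr0 -val_eqE /= gtn_eqF.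
by move=> /prodf_neq0/(_ i isT); rewrite !mxE eqxx.
Qed.

End Schur.

(** Holds because A_B + lambda D_B = A_B (I + lambda E_B). *)
Lemma x_BP (R : realType) m n (A D : 'M[R]_(m, n)) b B (lambda : R) :
  is_basis A B -> 1%:M + lambda *: E_B A D B \in unitmx ->
  (1%:M + lambda *: E_B A D B) *m x_B A D b B lambda = x_B A D b B 0.
Proof.
move=> A_unit shift_unit.
have AB_eq : colsub B A + lambda *: colsub B D =
    colsub B A *m (1%:M + lambda *: E_B A D B).
  by rewrite mulmxDr mulmx1 -scalemxAr mulKVmx.
have AB_unit : colsub B A + lambda *: colsub B D \in unitmx.
  by rewrite AB_eq unitmx_mul shift_unit andbT.
rewrite {2}/x_B scale0r addr0; apply: (canRL (mulKmx A_unit)).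
by rewrite mulmxA -AB_eq /x_B mulKVmx.
Qed.

(** * The programs *)

(** The table starts with Q, U and Q^H (m^2 entries each) and x_B(0) (m
    entries); the further values are y = Q^H x_B(0), the row w^T = c_B^T Q, and
    the constants 0 and 1, which must be stored because a program contains no
    scalar. *)
Definition addr_Q m (i j : 'I_m) : nat := (i * m + j)%N.
Definition addr_U m (i j : 'I_m) : nat := (m * m + (i * m + j))%N.
Definition addr_y m (i : 'I_m) : nat := (3 * (m * m) + m + i)%N.
Definition addr_w m (i : 'I_m) : nat := (3 * (m * m) + 2 * m + i)%N.
Definition addr_zero (m : nat) : nat := (3 * (m * m) + 3 * m)%N.
Definition addr_one (m : nat) : nat := (addr_zero m).+1.

Definition solve_schur (m : nat) : seq instruction * ('I_m -> operand) :=
  solve (addr_zero m) (addr_one m) (@addr_U m) (@addr_y m) (enum 'I_m).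

Definition program_x (m : nat) : program :=
  let: (s, z) := solve_schur m in
  let: (s', l) :=
    matvec (addr_zero m) (@addr_Q m) z (enum 'I_m) s (enum 'I_m) in
  Program s' l.

Definition program_o (m : nat) : program :=
  let: (s, z) := solve_schur m in
  let: (s', a) :=
    dot s (Table (addr_zero m)) [seq (Table (addr_w j), z j) | j <- enum 'I_m] in
  Program s' [:: a].

Lemma cost_program_x m : cost (program_x m) = (3 * m ^ 2 + 4 * m)%N.
Proof.
rewrite /program_x /solve_schur.
have := size_solve (addr_zero m) (addr_one m) (@addr_U m) (@addr_y m) (enum 'I_m).
case: solve => s z /=.
have := size_matvec (addr_zero m) (@addr_Q m) z (enum 'I_m) s (enum 'I_m).
case: matvec => s' l /=; rewrite /cost /= size_enum_ord => -> ->; ring.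
Qed.

Lemma cost_program_o m : cost (program_o m) = (m ^ 2 + 6 * m)%N.
Proof.
rewrite /program_o /solve_schur.
have := size_solve (addr_zero m) (addr_one m) (@addr_U m) (@addr_y m) (enum 'I_m).
case: solve => s z /=.
have := size_dot s (Table (addr_zero m))
  [seq (Table (addr_w j), z j) | j <- enum 'I_m].
case: dot => s' a /=; rewrite /cost /= size_map size_enum_ord => -> ->; ring.
Qed.

Section Correctness.

Local Open Scope sesquilinear_scope.

Variables (R : realType) (m : nat) (E : 'M[R]_m) (Q U : 'M[R[i]]_m).
Variables (x0 : 'cV[R]_m) (cB : 'cV[R]_m).
Hypothesis schurE : schur_decomposition E Q U.

Let y := Q^t* *m to_complex x0.
Let w := (to_complex cB)^T *m Q.

Definition further_values : seq R[i] := entries y ++ entries w ++ [:: 0; 1].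

Let tab := preprocessed Q U x0 further_values.

Lemma onth_Q i j : onth tab (addr_Q i j) = Some (Q i j).
Proof. exact: (@onth_entries _ _ _ Q [::]). Qed.

Lemma onth_U i j : onth tab (addr_U i j) = Some (U i j).
Proof.
by rewrite /addr_U -(size_entries Q); apply: (onth_entries U (entries Q)).
Qed.

Let before_y :=
  entries Q ++ entries U ++ entries (Q^t*) ++ entries (to_complex x0).

Let size_before_y : size before_y = (3 * (m * m) + m)%N.
Proof. rewrite !size_cat !size_entries; ring. Qed.

Lemma tab_split : tab = before_y ++ further_values.
Proof. by rewrite /tab /preprocessed /before_y !catA. Qed.

Lemma onth_y i : onth tab (addr_y i) = Some (y i 0).
Proof.
have := onth_entries y before_y (entries w ++ [:: 0; 1]) i 0.
by rewrite size_before_y -tab_split muln1 addn0.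
Qed.

Lemma onth_w j : onth tab (addr_w j) = Some (w 0 j).
Proof.
have := onth_entries w (before_y ++ entries y) [:: 0; 1] 0 j.
rewrite -catA -tab_split size_cat size_before_y size_entries => <-.
by congr onth; rewrite /addr_w /=; ring.
Qed.

Lemma onth_const k : onth tab (addr_zero m + k) = onth [:: 0; 1] k.
Proof.
rewrite tab_split /further_values 2!catA onth_cat.
have -> : size ((before_y ++ entries y) ++ entries w) = addr_zero m.
  by rewrite 2!size_cat size_before_y !size_entries /addr_zero; ring.
by rewrite ltnNge leq_addr /= addKn.
Qed.

Lemma onth_zero : onth tab (addr_zero m) = Some 0.
Proof. by rewrite -[addr_zero m]addn0 onth_const. Qed.

Lemma onth_one : onth tab (addr_one m) = Some 1.
Proof. by rewrite /addr_one -addn1 onth_const. Qed.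

Variables (lambda : R) (x : 'cV[R]_m).
Hypothesis shift_unit : 1%:M + lambda *: E \in unitmx.
Hypothesis x_eq : (1%:M + lambda *: E) *m x = x0.

Let z := Q^t* *m to_complex x.

Let Qz_eq : Q *m z = to_complex x.
Proof.
by have [/unitarymxP QQ _ _] := schurE; rewrite mulmxA QQ mul1mx.
Qed.

Lemma solve_schurP :
  let: (s, a) := solve_schur m in
  evals tab lambda%:C s Param lambda%:C /\
  {in enum 'I_m, forall j, evals tab lambda%:C s (a j) (z j 0)}.
Proof.
apply: (solveP (vy := fun i => y i 0) (vu := fun i j => U i j)).
- exact: onth_zero.
- exact: onth_one.
- exact: onth_U.
- exact: onth_y.
move=> p i q enum_eq; have [_ U_trig _] := schurE; split.
  exact: schur_diag_neq0 schurE _ _ shift_unit.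
apply: back_substitution_row U_trig _ enum_eq.
exact: schur_coordinatesP schurE _ _ _ x_eq.
Qed.

Lemma program_xP :
  computes (program_x m) tab lambda%:C (entries (to_complex x)).
Proof.
rewrite /program_x; move: solve_schurP; case: solve_schur => s a [run_s ev_z].
have := matvecP (enum 'I_m) onth_zero onth_Q run_s ev_z.
case: matvec => s' l [_]; congr computes; rewrite -Qz_eq /entries.
rewrite (_ : enum 'I_1 = [:: 0]); last first.
  by apply: (inj_map val_inj); rewrite val_enum_ord.
rewrite allpairs1r; apply: eq_map => i /=; by rewrite mxE big_enum.
Qed.

Lemma program_oP :
  computes (program_o m) tab lambda%:C [:: ((cB^T *m x) 0 0)%:C].
Proof.
rewrite /program_o; move: solve_schurP; case: solve_schur => s a [run_s ev_z].
have := dotP (evals_Table onth_zero run_s)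
  (fun j _ => evals_Table (onth_w j) run_s) ev_z.
case: dot => s' acc [_]; rewrite add0r big_enum /=; congr (evals _ _ _ _ _).
transitivity ((w *m z) 0 0); first by rewrite mxE.
by rewrite -mulmxA Qz_eq /to_complex map_trmx -map_mxM mxE.
Qed.

End Correctness.

Theorem theorem4 (R : realType) :
  exists K : nat, forall m : nat, exists prog_x prog_o : program,
  [/\ (cost prog_x <= K * m ^ 2)%N,
      (cost prog_o <= K * m ^ 2)%N &
      forall (n : nat) (A D : 'M[R]_(m, n)) (b : 'cV[R]_m) (c : 'cV[R]_n)
        (B : 'I_m -> 'I_n) (Q U : 'M[R[i]]_m),
      is_basis A B ->
      schur_decomposition (E_B A D B) Q U ->
      exists extra : seq R[i],
      let tab := preprocessed Q U (x_B A D b B 0) extra in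
      forall lambda : R,
      1%:M + lambda *: E_B A D B \in unitmx ->
      computes prog_x tab lambda%:C (entries (to_complex (x_B A D b B lambda)))
      /\ computes prog_o tab lambda%:C [:: (o_B A D b c B lambda)%:C]].
Proof.
(* The costs are 3m^2 + 4m and m^2 + 6m, and m <= m^2. *)
exists 7%N => m; exists (program_x m), (program_o m).
have le_m : (m <= m ^ 2)%N by case: m => // k; rewrite expnS leq_pmulr.
split=> [||n A D b c B Q U A_unit schurE].
- by rewrite cost_program_x (mulnDl 3 4) leq_add2l leq_mul2l le_m.
- by rewrite cost_program_o (mulnDl 1 6) mul1n leq_add2l leq_mul2l le_m.
exists (further_values Q (x_B A D b B 0) (rowsub B c)) => /= lambda shift_unit.
have x_eq := x_BP b A_unit shift_unit.
by split; [apply: program_xP x_eq | apply: program_oP x_eq].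
Qed.
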